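(* Let $n$ be a nonnegative integer and let $p(q)=a_0+qa_1+q^2a_2+\dots+q^na_n\not\equiv 0$ be an octonionic polynomial of degree $n$ in the variable $q\in\mathbb{O}$, where $a_k=\sum_{\ell=0}^7a_{k,\ell}e_\ell\in\mathbb{O}$ with $a_{k,\ell}\in\mathbb{R}$ for $k=0,1,2,\dots,n$. If $$0\leq a_{0,0}\leq a_{1,0}\leq\dots\leq a_{n,0},\qquad a_{n,0}\neq 0,$$ then all the zeros of $p$ in $\mathbb{O}$ lie in $$|q|\leq 1+\frac{2}{a_{n,0}}\sum_{k=0}^n\sum_{\ell=1}^7|a_{k,\ell}|.$$
   Context: $\mathbb{O}$ denotes the (nonassociative, alternative) real division algebra of octonions, with real basis $e_0=1,e_1,\dots,e_7$ and multiplication $e_\alpha e_\beta=-\delta_{\alpha\beta}+\sum_{\gamma=1}^7\psi_{\alpha\beta\gamma}e_\gamma$ for $\alpha,\beta\in\{1,\dots,7\}$, where $\psi$ is totally antisymmetric, equals $1$ on the triples $(1,2,3),(1,4,5),(2,4,6),(3,4,7),(2,5,7),(1,7,6),(5,3,6)$, and vanishes on triples not obtained by permuting one of these. Every octonion is $\omega=\sum_{k=0}^7x_ke_k$ with $x_k\in\mathbb{R}$, and $|\omega|=\left(\sum_{k=0}^7x_k^2\right)^{1/2}$. Powers $q^k$ are unambiguous since $\mathbb{O}$ is power-associative, and $q^ka_k$ means the product of the octonion $q^k$ with the octonion $a_k$ on its right. A zero of $p$ is a $q\in\mathbb{O}$ with $p(q)=0$. *)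

(* Defs.v *)
From mathcomp Require Import all_boot all_order all_algebra.
From mathcomp Require Import reals.

Set Implicit Arguments.
Unset Strict Implicit.
Unset Printing Implicit Defensive.

Import Order.TTheory GRing.Theory Num.Theory.
Local Open Scope ring_scope.

(* An octonion is the row vector of its real coordinates (x_0, ..., x_7) in
   the basis e_0 = 1, e_1, ..., e_7; the additive and real vector space
   structures are those of row vectors. *)
Notation octonion R := 'rV[R]_8.

Definition oct_triples : seq (nat * nat * nat) :=
  [:: (1, 2, 3); (1, 4, 5); (2, 4, 6); (3, 4, 7);
      (2, 5, 7); (1, 7, 6); (5, 3, 6)]%N.

Definition oct_even (i j k : nat) : bool :=
  [|| (i, j, k) \in oct_triples, (j, k, i) \in oct_triples
    | (k, i, j) \in oct_triples].

(* The even permutations of three indices are the cyclic ones, and the odd ones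
   are a transposition followed by a cyclic one. *)
Definition oct_psi (R : nzRingType) (i j k : nat) : R :=
  (oct_even i j k)%:R - (oct_even j i k)%:R.

Definition oct_e (R : nzRingType) (i : 'I_8) : octonion R := delta_mx 0 i.

Definition oct1 (R : nzRingType) : octonion R := oct_e R ord0.

Definition oct_emul (R : nzRingType) (i j : 'I_8) : octonion R :=
  if i == ord0 then oct_e R j
  else if j == ord0 then oct_e R i
  else - ((i == j)%:R *: oct_e R ord0)
       + \sum_(k < 8 | k != ord0) oct_psi R i j k *: oct_e R k.

Definition oct_mul (R : nzRingType) (x y : octonion R) : octonion R :=
  \sum_(i < 8) \sum_(j < 8) (x 0 i * y 0 j) *: oct_emul R i j.

(* q (q (... (q 1))); by power-associativity the bracketing is immaterial. *)
Definition oct_pow (R : nzRingType) (q : octonion R) (k : nat) : octonion R :=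
  iter k (oct_mul q) (oct1 R).

(* The Euclidean norm, not the default (sup) norm of row vectors. *)
Definition oct_norm (R : realType) (x : octonion R) : R :=
  Num.sqrt (\sum_(k < 8) x 0 k ^+ 2).

(* a_0 + q a_1 + ... + q^n a_n; the values of a beyond n are irrelevant. *)
Definition oct_poly (R : nzRingType) (n : nat) (a : nat -> octonion R)
    (q : octonion R) : octonion R :=
  \sum_(k < n.+1) oct_mul (oct_pow q k) (a k).

(* Main.v *)
(* For |q| <= 1 there is nothing to prove.  Left multiplication L by q satisfies
   L^2 = 2 q_0 L - |q|^2, so that (q q) a = q (q a), hence q^k a = L^k a, and
   p(q) - q p(q) = 0 telescopes into
     q^(n+1) a_n = a_0 + sum_(k < n) q^(k+1) (a_(k+1) - a_k).
   The norm is multiplicative, so for r = |q| > 1, writing b_k for the sum of the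
   |a_(k,l)| with l >= 1,
     r^(n+1) a_(n,0) <= r^n (|a_0| + sum_(k < n) |a_(k+1) - a_k|)
                     <= r^n (a_(n,0) + 2 sum_(k <= n) b_k),
   where the real parts telescope by monotonicity. *)
From HB Require Import structures.
Require Import Defs.
From mathcomp Require Import all_boot all_order all_algebra.
From mathcomp Require Import reals.
From mathcomp Require Import ring lra.
Import Order.TTheory GRing.Theory Num.Theory.
Local Open Scope ring_scope.

(** * Structure constants and the product in coordinates *)

Definition oct_struct (R : nzRingType) (i j k : nat) : R :=
  if i == 0%N then (k == j)%:R
  else if j == 0%N then (k == i)%:R
  else if k == 0%N then - (i == j)%:R
  else oct_psi R i j k.

Lemma oct_emulE (R : nzRingType) (i j k : 'I_8) :
  oct_emul R i j 0 k = oct_struct R i j k.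
Proof.
rewrite /oct_emul /oct_struct !(inj_eq val_inj _ ord0) -!val_eqE /=.
case: ifP => _; first by rewrite mxE eqxx.
case: ifP => _; first by rewrite mxE eqxx.
rewrite !mxE eqxx summxE -val_eqE /=; case: ifP => k0.
  rewrite mulr1 big1 ?addr0 // => l; rewrite -val_eqE /= => l0.
  by rewrite !mxE -[k == l]val_eqE /= (eqP k0) eq_sym (negPf l0) mulr0.
rewrite mulr0 oppr0 add0r (bigD1 k) /= -?val_eqE ?k0 //= !mxE !eqxx mulr1.
rewrite big1 ?addr0 // => l /andP[_ /negPf lk].
by rewrite !mxE [k == l]eq_sym lk mulr0.
Qed.

(** The sums range over natural numbers rather than ordinals, so that they unfold to explicit terms
    in which [oct_struct] evaluates on literals. *)
Lemma oct_mulE (R : nzRingType) (x y : octonion R) (k : 'I_8) :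
  oct_mul x y 0 k = \sum_(0 <= i < 8) \sum_(0 <= j < 8)
    x 0 (inord i) * y 0 (inord j) * oct_struct R i j k.
Proof.
rewrite big_mkord summxE; apply: eq_bigr => i _.
rewrite big_mkord summxE; apply: eq_bigr => j _.
by rewrite mxE oct_emulE !inord_val.
Qed.

(** The multiplication table written out: with it, identities between octonions become polynomial
    identities within reach of [ring]. *)
Lemma oct_mul_coord (R : comNzRingType) (x y : octonion R) (k : 'I_8) :
  let a i := x 0 (inord i) in let b i := y 0 (inord i) in
  oct_mul x y 0 k =
    [:: a 0 * b 0 - a 1 * b 1 - a 2 * b 2 - a 3 * b 3
          - a 4 * b 4 - a 5 * b 5 - a 6 * b 6 - a 7 * b 7;
        a 0 * b 1 + a 1 * b 0 + a 2 * b 3 - a 3 * b 2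
          + a 4 * b 5 - a 5 * b 4 - a 6 * b 7 + a 7 * b 6;
        a 0 * b 2 - a 1 * b 3 + a 2 * b 0 + a 3 * b 1
          + a 4 * b 6 + a 5 * b 7 - a 6 * b 4 - a 7 * b 5;
        a 0 * b 3 + a 1 * b 2 - a 2 * b 1 + a 3 * b 0
          + a 4 * b 7 - a 5 * b 6 + a 6 * b 5 - a 7 * b 4;
        a 0 * b 4 - a 1 * b 5 - a 2 * b 6 - a 3 * b 7
          + a 4 * b 0 + a 5 * b 1 + a 6 * b 2 + a 7 * b 3;
        a 0 * b 5 + a 1 * b 4 - a 2 * b 7 + a 3 * b 6
          - a 4 * b 1 + a 5 * b 0 - a 6 * b 3 + a 7 * b 2;
        a 0 * b 6 + a 1 * b 7 + a 2 * b 4 - a 3 * b 5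
          - a 4 * b 2 + a 5 * b 3 + a 6 * b 0 - a 7 * b 1;
        a 0 * b 7 - a 1 * b 6 + a 2 * b 5 + a 3 * b 4
          - a 4 * b 3 - a 5 * b 2 + a 6 * b 1 + a 7 * b 0]`_k.
Proof.
rewrite /= oct_mulE.
case: k => -[|[|[|[|[|[|[|[|//]]]]]]]] _ /=;
  rewrite /index_iota unlock /= /oct_struct /oct_psi /oct_even /=; ring.
Qed.

(** * Multiplicativity of the squared norm and the quadratic relation *)

Definition oct_sqn {R : nzRingType} (x : octonion R) : R :=
  \sum_(k < 8) x 0 k ^+ 2.

Lemma oct_sqnE (R : nzRingType) (x : octonion R) :
  oct_sqn x = \sum_(0 <= k < 8) x 0 (inord k) ^+ 2.
Proof. by rewrite big_mkord; apply: eq_bigr => k _; rewrite inord_val. Qed.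

(** Degen's eight-square identity. *)
Lemma oct_sqnM (R : comNzRingType) (x y : octonion R) :
  oct_sqn (oct_mul x y) = oct_sqn x * oct_sqn y.
Proof.
rewrite !oct_sqnE; under eq_big_nat => k lk do rewrite oct_mul_coord inordK //.
rewrite /index_iota unlock /=; ring.
Qed.

(** A polynomial identity in each coordinate. Its case [y = 1] expresses [x x] through [x] and 1,
    and comparing the two gives left alternativity. *)
Lemma oct_mul_quad (R : comNzRingType) (x y : octonion R) :
  oct_mul x (oct_mul x y) = (2 * x 0 ord0) *: oct_mul x y - oct_sqn x *: y.
Proof.
(* All coordinates are brought to the form [inord i], so that [ring] sees the same atoms on both
   sides. *)
have -> : ord0 = inord 0 :> 'I_8 by apply: val_inj; rewrite /= inordK.
apply/rowP => k; rewrite !mxE !oct_mul_coord oct_sqnE !inordK //.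
rewrite -[y 0 k](congr1 (y 0) (inord_val k)) /index_iota unlock.
case: k => -[|[|[|[|[|[|[|[|//]]]]]]]] _ /=; ring.
Qed.

(** * Linearity, alternativity and powers *)

Lemma oct_mulPl (R : comNzRingType) (c d : R) (x y z : octonion R) :
  oct_mul (c *: x + d *: y) z = c *: oct_mul x z + d *: oct_mul y z.
Proof.
rewrite /oct_mul !scaler_sumr -big_split; apply: eq_bigr => i _ /=.
rewrite !scaler_sumr -big_split; apply: eq_bigr => j _ /=.
by rewrite !mxE mulrDl scalerDl !scalerA !mulrA.
Qed.

Lemma oct_mul_is_linear (R : comNzRingType) (x : octonion R) :
  linear (oct_mul x).
Proof.
move=> c y z; rewrite /oct_mul scaler_sumr -big_split; apply: eq_bigr => i _ /=.
rewrite scaler_sumr -big_split; apply: eq_bigr => j _ /=.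
by rewrite !mxE mulrDr scalerDl scalerA mulrCA.
Qed.

HB.instance Definition _ (R : comNzRingType) (x : octonion R) :=
  GRing.isLinear.Build R (octonion R) (octonion R) _ (oct_mul x)
    (oct_mul_is_linear R x).

Lemma oct_mul1l (R : comNzRingType) (x : octonion R) : oct_mul (oct1 R) x = x.
Proof.
rewrite /oct_mul (bigD1 ord0) //= [X in _ + X]big1 ?addr0 => [|i i0].
  rewrite [RHS]row_sum_delta; apply: eq_bigr => j _.
  by rewrite mxE mul1r.
by rewrite big1 // => j _; rewrite mxE (negPf i0) andbF mul0r scale0r.
Qed.

Lemma oct_mulr1 (R : comNzRingType) (x : octonion R) : oct_mul x (oct1 R) = x.
Proof.
rewrite /oct_mul [RHS]row_sum_delta; apply: eq_bigr => i _.
rewrite (bigD1 ord0) //= big1 ?addr0 => [|j j0].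
  by rewrite mxE mulr1 /oct_emul eqxx; case: eqP => // ->.
by rewrite mxE (negPf j0) andbF mulr0 scale0r.
Qed.

Lemma oct_mulxx (R : comNzRingType) (x : octonion R) :
  oct_mul x x = (2 * x 0 ord0) *: x + (- oct_sqn x) *: oct1 R.
Proof.
by rewrite -{2}(oct_mulr1 _ x) oct_mul_quad oct_mulr1 scaleNr.
Qed.

Lemma oct_mul_alt (R : comNzRingType) (x y : octonion R) :
  oct_mul (oct_mul x x) y = oct_mul x (oct_mul x y).
Proof. by rewrite oct_mul_quad oct_mulxx oct_mulPl oct_mul1l scaleNr. Qed.

(** The plane spanned by [q] and 1 is stable under left multiplication by [q], because [q q] lies in
    it. *)
Lemma oct_pow_span (R : comNzRingType) (q : octonion R) (k : nat) :
  exists s t, oct_pow q k = s *: q + t *: oct1 R.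
Proof.
elim: k => [|k [s [t IH]]]; first by exists 0, 1; rewrite scale0r add0r scale1r.
(* Coefficients of [s (q q) + t q] after replacing [q q] by [2 q_0 q - |q|^2]. *)
exists (s * (2 * q 0 ord0) + t), (- (s * oct_sqn q)).
rewrite [LHS]/= -/(oct_pow q k) IH linearD !linearZ /= oct_mulr1 oct_mulxx.
by rewrite scalerDr !scalerA scalerDl mulrN addrAC.
Qed.

(** Writing [q^k = s q + t], the only reassociation required is [(q q) x = q (q x)], so
    alternativity replaces associativity. *)
Lemma oct_mul_pow (R : comNzRingType) (q x : octonion R) (k : nat) :
  oct_mul (oct_pow q k) x = iter k (oct_mul q) x.
Proof.
elim: k => [|k IH]; first exact: oct_mul1l.
rewrite iterS -{}IH [oct_pow _ _]/= -/(oct_pow q k).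
have [s [t ->]] := oct_pow_span _ q k.
by rewrite linearD !linearZ /= oct_mulr1 !oct_mulPl linearD !linearZ /=
  oct_mul_alt oct_mul1l.
Qed.

(** * The Euclidean norm *)

Lemma oct_norm_ge0 (R : realType) (x : octonion R) : 0 <= oct_norm x.
Proof. exact: sqrtr_ge0. Qed.

Lemma oct_normM (R : realType) (x y : octonion R) :
  oct_norm (oct_mul x y) = oct_norm x * oct_norm y.
Proof.
rewrite -[LHS]/(Num.sqrt (oct_sqn _)) oct_sqnM sqrtrM //.
by apply: sumr_ge0 => i _; apply: sqr_ge0.
Qed.

Lemma oct_normX (R : realType) (q x : octonion R) (k : nat) :
  oct_norm (iter k (oct_mul q) x) = oct_norm q ^+ k * oct_norm x.
Proof.
elim: k => [|k IH]; first by rewrite expr0 mul1r.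
by rewrite iterS oct_normM IH exprS mulrA.
Qed.

Lemma oct_normZ (R : realType) (c : R) (x : octonion R) :
  oct_norm (c *: x) = `|c| * oct_norm x.
Proof.
rewrite /oct_norm; under eq_bigr => i _ do rewrite mxE exprMn.
by rewrite -mulr_sumr sqrtrM ?sqr_ge0 // sqrtr_sqr.
Qed.

(** Reduces to the Cauchy-Schwarz inequality [c <= |x| |y|] for the inner product [c]. *)
Lemma oct_normD (R : realType) (x y : octonion R) :
  oct_norm (x + y) <= oct_norm x + oct_norm y.
Proof.
have sqn_ge0 (z : octonion R) : 0 <= oct_sqn z.
  by apply: sumr_ge0 => i _; apply: sqr_ge0.
have normE (z : octonion R) : oct_norm z ^+ 2 = oct_sqn z
  by rewrite /oct_norm sqr_sqrtr ?sqn_ge0.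
pose c := \sum_(i < 8) x 0 i * y 0 i.
have combE (s t : R) : oct_sqn (s *: x + t *: y)
    = s ^+ 2 * oct_sqn x + 2 * (s * t) * c + t ^+ 2 * oct_sqn y.
  rewrite !mulr_sumr -!big_split; apply: eq_bigr => i _ /=.
  by rewrite !mxE; ring.
have xyE : oct_sqn (x + y) = oct_sqn x + 2 * c + oct_sqn y.
  by have := combE 1 1; rewrite !scale1r => ->; ring.
suff cle : c <= oct_norm x * oct_norm y.
  rewrite -ler_sqr ?nnegrE ?addr_ge0 ?oct_norm_ge0 // normE xyE -!normE.
  by nra.
have := oct_norm_ge0 _ x; have := oct_norm_ge0 _ y.
(* With [u = |x|] and [v = |y|], the squared norm of [v x - u y] equals [2 u v (u v - c)]. *)
have := sqn_ge0 (oct_norm y *: x + (- oct_norm x) *: y).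
rewrite combE -!normE; set u := oct_norm x; set v := oct_norm y => H v0 u0.
have {}H : 0 <= (u * v) * (u * v - c) by nra.
(* The factor [u v] cancels if positive; otherwise one of the vectors is zero and [c = 0]. *)
have [uv0|uv0] := ltP 0 (u * v); first by move: H; rewrite pmulr_rge0 // subr_ge0.
have u_v : u * v = 0 by apply/le_anti; rewrite uv0 mulr_ge0.
have zero (z : octonion R) : oct_norm z = 0 -> forall i, z 0 i = 0.
  move=> z0 i; apply/eqP; rewrite -sqrf_eq0.
  have /eqP := normE z; rewrite z0 expr0n /= eq_sym psumr_eq0 => [/allP/(_ i)|? _].
    by rewrite mem_index_enum => /(_ isT).
  exact: sqr_ge0.
rewrite u_v /c big1 // => i _.
by move/eqP: u_v; rewrite mulf_eq0 => /orP[] /eqP/zero ->; rewrite ?mul0r ?mulr0.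
Qed.

Lemma oct_norm_sum (R : realType) (I : Type) (s : seq I) (F : I -> octonion R) :
  oct_norm (\sum_(i <- s) F i) <= \sum_(i <- s) oct_norm (F i).
Proof.
elim/big_ind2: _ => [|x u y v xu yv|//].
  by rewrite -(scale0r 0) oct_normZ normr0 mul0r.
exact: le_trans (oct_normD _ _ _) (lerD xu yv).
Qed.

(** Triangle inequality on the basis expansion. The real coordinate is kept apart because
    monotonicity controls only that one. *)
Lemma oct_norm_le_coord (R : realType) (x : octonion R) :
  oct_norm x <= `|x 0 ord0| + \sum_(l < 8 | l != ord0) `|x 0 l|.
Proof.
rewrite {1}[x]row_sum_delta.
apply: le_trans (oct_norm_sum _ _ _ _) _.
rewrite [leRHS](_ : _ = \sum_(l < 8) `|x 0 l|); last by rewrite [RHS](bigD1 ord0).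
apply: ler_sum => l _; rewrite oct_normZ /oct_norm (bigD1 l) //= big1.
  by rewrite mxE !eqxx expr1n addr0 sqrtr1 mulr1.
by move=> i /negPf il; rewrite mxE il andbF expr0n.
Qed.

Lemma coord0_le_oct_norm (R : realType) (x : octonion R) : `|x 0 ord0| <= oct_norm x.
Proof.
rewrite -sqrtr_sqr ler_wsqrtr // (bigD1 ord0) //= lerDl.
by apply: sumr_ge0 => i _; apply: sqr_ge0.
Qed.

(** * Telescoping at a zero and the final estimate *)

Lemma oct_poly_root_telescope (R : comNzRingType) (n : nat)
    (a : nat -> octonion R) (q : octonion R) :
  oct_poly n a q = 0 ->
  iter n.+1 (oct_mul q) (a n)
    = a 0%N + \sum_(k < n) iter k.+1 (oct_mul q) (a k.+1 - a k).
Proof.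
move=> pq0.
have pE : \sum_(k < n.+1) iter k (oct_mul q) (a k) = 0.
  by rewrite -[RHS]pq0; apply: eq_bigr => k _; rewrite oct_mul_pow.
have iterB k (x y : octonion R) : iter k (oct_mul q) (x - y)
    = iter k (oct_mul q) x - iter k (oct_mul q) y.
  by elim: k => //= k ->; rewrite linearB.
(* The top term is split off from [q p(q)] and the bottom term from [p(q)], so that the remaining
   sums match index by index. *)
have := congr1 (oct_mul q) pE; rewrite linear0 linear_sum big_ord_recr /=.
move: pE; rewrite big_ord_recl /= => pE qpE.
under eq_bigr => k _ do rewrite -iterS iterB.
rewrite sumrB addrA; move: pE; rewrite /bump /= => ->.
by apply/eqP; rewrite sub0r -addr_eq0 addrC; apply/eqP.
Qed.

Theorem theorem3p8 (R : realType) (n : nat) (a : nat -> octonion R)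
  (p_neq0 : exists q : octonion R, oct_poly n a q != 0)
  (deg_p : a n != 0)
  (a00_ge0 : 0 <= a 0%N 0 ord0)
  (a_mono : forall k : nat, (k < n)%N -> a k 0 ord0 <= a k.+1 0 ord0)
  (an0_neq0 : a n 0 ord0 != 0) :
  forall q : octonion R, oct_poly n a q = 0 ->
    oct_norm q <=
      1 + 2 / a n 0 ord0 *
            \sum_(k < n.+1) \sum_(l < 8 | l != ord0) `|a k 0 l|.
Proof.
move=> q /oct_poly_root_telescope qE.
pose b k := \sum_(l < 8 | l != ord0) `|a k 0 l|.
have b_ge0 k : 0 <= b k by apply: sumr_ge0.
have a_ge0 : 0 <= a n 0 ord0.
  (* Induction on an index at most [n], as monotonicity is assumed only up to [n]. *)
  by elim: {-2}n (leqnn n) => // k IH kn; apply: le_trans (IH (ltnW kn)) (a_mono _ kn).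
have a_gt0 : 0 < a n 0 ord0 by rewrite lt_def an0_neq0.
rewrite -[\sum_(k < n.+1) _]/(\sum_(k < n.+1) b k) mulrAC.
have [r_le1|r_gt1] := leP (oct_norm q) 1.
  apply: le_trans r_le1 _; rewrite lerDl divr_ge0 // mulr_ge0 //.
  exact: sumr_ge0.
have r_ge0 := oct_norm_ge0 _ q.
(* The goal becomes [r a_(n,0) <= a_(n,0) + 2 sum b_k] with [r = |q|], and is then multiplied by
   [r^n]. *)
rewrite addrC -lerBlDr ler_pdivlMr // mulrBl mul1r lerBlDl.
have rn_gt0 : 0 < oct_norm q ^+ n by rewrite exprn_gt0 // (lt_trans ltr01).
rewrite -(ler_pM2l rn_gt0) mulrA -exprSr.
have an_le : a n 0 ord0 <= oct_norm (a n).
  exact: le_trans (ler_norm _) (coord0_le_oct_norm _ _).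
apply: le_trans (ler_wpM2l (exprn_ge0 _ r_ge0) an_le) _.
rewrite -oct_normX qE.
apply: le_trans (oct_normD _ _ _) _.
have a0_le : oct_norm (a 0%N) <= a 0%N 0 ord0 + b 0%N.
  by apply: le_trans (oct_norm_le_coord _ _) _; rewrite ger0_norm.
have step k : (k < n)%N ->
    oct_norm (a k.+1 - a k) <= (a k.+1 0 ord0 - a k 0 ord0) + (b k.+1 + b k).
  move=> kn; apply: le_trans (oct_norm_le_coord _ _) _; rewrite lerD //.
    by rewrite !mxE ger0_norm // subr_ge0 a_mono.
  by rewrite -big_split; apply: ler_sum => l _; rewrite !mxE ler_normB.
have main : oct_norm (\sum_(k < n) iter k.+1 (oct_mul q) (a k.+1 - a k)) <=
    oct_norm q ^+ n *
      \sum_(k < n) ((a k.+1 0 ord0 - a k 0 ord0) + (b k.+1 + b k)).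
  apply: le_trans (oct_norm_sum _ _ _ _) _; rewrite mulr_sumr.
  (* Here [r^(k+1) <= r^n], since [r > 1] and [k < n]. *)
  apply: ler_sum => k _; rewrite oct_normX ler_pM ?exprn_ge0 ?oct_norm_ge0 ?step //.
  by rewrite ler_weXn2l // ltW.
have a0_le' : oct_norm (a 0%N) <= oct_norm q ^+ n * (a 0%N 0 ord0 + b 0%N).
  apply: le_trans a0_le _; rewrite ler_peMl ?addr_ge0 //.
  by rewrite exprn_ege1 // ltW.
apply: le_trans (lerD a0_le' main) _; rewrite -mulrDr ler_pM2l //.
have tele : \sum_(k < n) (a k.+1 0 ord0 - a k 0 ord0)
    = a n 0 ord0 - a 0%N 0 ord0.
  rewrite -(telescope_sumr (fun k => a k 0 ord0) (leq0n n)).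
  by rewrite big_mkord.
have Sl : \sum_(k < n.+1) b k = b 0%N + \sum_(k < n) b k.+1.
  by rewrite big_ord_recl.
have Sr : \sum_(k < n.+1) b k = \sum_(k < n) b k + b n.
  by rewrite big_ord_recr.
(* The real parts collapse to [a_(n,0)], and the [b] terms add up to [2 sum b_k - b_n], where
   [b_n >= 0]. *)
by rewrite big_split /= tele big_split /=; have := b_ge0 n; lra.
Qed.
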